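(* The quotient $R[\mathbf{x}]/(\mathcal{MG}^+)$ is a free $R$-module with basis $\mathcal{O}$, and the $\mathcal{O}$-border pre-basis $\mathcal{MG}=\{b_j+Y(b_j)+\tau(b_j)\mid b_j\in\partial\mathcal{O}\}$ is an $\mathcal{O}$-border basis (i.e. $R[\mathbf{x}]/(\mathcal{MG})$ is a free $R$-module with basis the images of the elements of $\mathcal{O}$).
   Context: $K$ is an algebraically closed field of characteristic $0$, $K[\mathbf{x}]=K[x_1,\dots,x_n]$, $\mathbb{T}^n$ is the set of monomials in $x_1,\dots,x_n$, $\mathbb{T}^n_d$ those of degree $d$. Monomial inequalities refer to lexicographic order with $x_1>\dots>x_n$ (on monomials of arbitrary degrees). Negative degree-lexicographic listing of monomials: $m$ comes before $m'$ iff $\deg m<\deg m'$, or $\deg m=\deg m'$ and $m>m'$. Admissible order ideal: fix integers $2\le r<s$ and monomials $\mathcal{W}_d\in\mathbb{T}^n_d$ for $r\le d\le s+1$ such that $\mathcal{W}_{s+1}=x_n^{s+1}$; $x_n\mathcal{W}_d\ge\mathcal{W}_{d+1}$ for $r\le d<s$; $\mathcal{W}_s>x_n^s$. Put $\mathcal{O}=\bigcup_{d=0}^{s+1}\mathcal{O}_d$, where $\mathcal{O}_d=\mathbb{T}^n_d$ for $d\le r-1$ and $\mathcal{O}_d=\{m\in\mathbb{T}^n_d\mid \mathcal{W}_d>m\}$ for $r\le d\le s+1$. Border: $\partial\mathcal{O}=(\bigcup_k x_k\mathcal{O})\setminus\mathcal{O}$. List $\mathcal{O}=\{t_1,\dots,t_\mu\}$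 and $\partial\mathcal{O}=\{b_1,\dots,b_\nu\}$ in negative degree-lexicographic order. $\mathcal{N}=\{m\in\mathbb{T}^n\mid r\le\deg m\le s+1,\ m\notin\mathcal{O}\}\supseteq\partial\mathcal{O}$, $\mathcal{N}_{\le s}=\{m\in\mathcal{N}\mid\deg m\le s\}$; $\operatorname{LM}=\{b\in\partial\mathcal{O}\mid\deg b\le s,\ x_k\mid b\Rightarrow b/x_k\in\mathcal{O}\ \forall k\}$; $\operatorname{TM}=\mathcal{O}_s$. $\mathcal{C}=\{C_{i,j}\mid t_i\in\operatorname{TM},\ b_j\in\operatorname{LM}\}$ are indeterminates. For $m\in\mathcal{N}$ put $Y(m)=-\sum_{t_i\in\operatorname{TM}}C_{i,j}t_i$ if $m=b_j\in\operatorname{LM}$ and $Y(m)=0$ otherwise. $\operatorname{lv}(m)$ is the largest variable dividing $m$ and $\operatorname{ld}(m)$ its exponent in $m$. $x_k$ is a key variable if $x_k=\operatorname{lv}(m)$ for some $m\in\mathcal{N}_{\le s}$; then the key monomial $\chi_k$ is the lex-minimal element of $\{m'\in\operatorname{LM}\mid\operatorname{lv}(m')=x_k\}$, written $\chi_k=x_k^{e_k}\hat m_k$ with $e_k=\operatorname{ld}(\chi_k)$. Target seed monomials: $\mathcal{T}_k=\{t/\hat m_k\mid t\in\mathcal{O},\ \deg t\ge\deg\chi_k,\ \hat m_k\mid t,\text{ and }\chi_k\in\operatorname{LM}\Rightarrow t\notin\operatorname{TM}\}=\{t_{k,1},\dots,t_{k,\rho_k}\}$. $\Theta=\{\theta_{k,q}\mid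 x_k\text{ key},1\le q\le\rho_k\}$ are further indeterminates, $\sigma_k=\sum_q\theta_{k,q}t_{k,q}$, and $R=K[\mathcal{C},\Theta]$. Initial target of $m\in\mathcal{N}$: if $\deg m\le s$ and $\operatorname{lv}(m)=x_k$, then $\tau'(m)$ is $(m/x_k^{e_k})\cdot\sigma_k$ with all terms of degree $\ge s+1$ deleted (here $\operatorname{ld}(m)\ge e_k$); if $\deg m=s+1$, $\tau'(m)=0$. Targets $\tau(m)\in\operatorname{Span}_R(\mathcal{O})$, $m\in\mathcal{N}$, are defined recursively, from the last to the first element of $\mathcal{N}$ in negative degree-lexicographic order: $\tau(m)$ is obtained from $\tau'(m)$ by replacing each monomial $m'\notin\mathcal{O}$ occurring in it by $-(Y(m')+\tau(m'))$ (each such $m'$ lies in $\mathcal{N}$ and comes after $m$). Finally $\mathcal{MG}^+=\{m+Y(m)+\tau(m)\mid m\in\mathcal{N}\}\subseteq R[\mathbf{x}]$. An $\mathcal{O}$-border pre-basis over a ring $R$ is a set $\{b_j-\sum_i c_{i,j}t_i\mid 1\le j\le\nu\}$ with $c_{i,j}\in R$; it is an $\mathcal{O}$-border basis if the quotient of $R[\mathbf{x}]$ by the ideal it generates is $R$-free with basis $\mathcal{O}$. *)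

(* Defs.v *)
From HB Require Import structures.
From mathcomp Require Import all_boot all_order all_algebra.
From mathcomp Require Import boolp.
From mathcomp Require Export mpoly.

Set Implicit Arguments.
Unset Strict Implicit.
Unset Printing Implicit Defensive.

Import GRing.Theory.
Local Open Scope ring_scope.

Section GeneratedIdeal.
Variables (A : comNzRingType) (B : comAlgType A).
Implicit Types (G : seq B) (p q : B).

(* Membership in a generated ideal is made boolean classically, as MathComp's
   quotients require. *)
Definition gen_ideal G : {pred B} :=
  fun p => `[< exists h : 'I_(size G) -> B, p = \sum_i h i * G`_i >].

Lemma gen_ideal_zmod_closed G : zmod_closed (gen_ideal G).
Proof.
split=> [|p q /asboolP[h ->] /asboolP[h' ->]]; apply/asboolP.
  by exists (fun=> 0); rewrite big1 // => i _; rewrite mul0r.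
exists (fun i => h i - h' i); rewrite -sumrB.
by apply: eq_bigr => i _; rewrite mulrBl.
Qed.

HB.instance Definition _ G :=
  GRing.isZmodClosed.Build B (gen_ideal G) (gen_ideal_zmod_closed G).

Lemma gen_idealZ G (a : A) p : p \in gen_ideal G -> a *: p \in gen_ideal G.
Proof.
move=> /asboolP[h ->]; apply/asboolP; exists (fun i => a *: h i).
by rewrite scaler_sumr; apply: eq_bigr => i _; rewrite scalerAl.
Qed.

(* The unit ideal is allowed, so the quotient is only given its A-module
   structure: MathComp's quotient rings require a proper ideal. *)
Definition quotient_mod G := {ideal_quot (gen_ideal G)}.

HB.instance Definition _ G := GRing.Zmodule.on (quotient_mod G).

Definition quotient_proj G (p : B) : quotient_mod G :=
  \pi_({ideal_quot (gen_ideal G)})%qT p.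

Definition quotient_scale G (a : A) (x : quotient_mod G) : quotient_mod G :=
  quotient_proj G (a *: repr (x : {ideal_quot (gen_ideal G)})).

Lemma quotient_projP G p q :
  reflect (quotient_proj G p = quotient_proj G q) (p - q \in gen_ideal G).
Proof. by rewrite Quotient.idealrBE; apply: eqP. Qed.

Lemma quotient_projD G p q :
  quotient_proj G (p + q) = quotient_proj G p + quotient_proj G q.
Proof. exact: (@pi_addr _ _ _ _ _ {ideal_quot (gen_ideal G)} p q). Qed.

Lemma quotient_projW G (P : quotient_mod G -> Prop) :
  (forall p, P (quotient_proj G p)) -> forall x, P x.
Proof.
move=> H x; have := H (repr (x : {ideal_quot (gen_ideal G)})).
by rewrite /quotient_proj reprK.
Qed.

Lemma quotient_scaleE G a p :
  quotient_scale a (quotient_proj G p) = quotient_proj G (a *: p).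
Proof.
apply/quotient_projP; rewrite -scalerBr; apply: gen_idealZ.
by apply/quotient_projP; rewrite {1}/quotient_proj reprK.
Qed.

Lemma quotient_scaleA G a b (x : quotient_mod G) :
  quotient_scale a (quotient_scale b x) = quotient_scale (a * b) x.
Proof. by elim/quotient_projW: x => p; rewrite !quotient_scaleE scalerA. Qed.

Lemma quotient_scale1 G : left_id 1 (@quotient_scale G).
Proof. by elim/quotient_projW => p; rewrite quotient_scaleE scale1r. Qed.

Lemma quotient_scaleDr G : right_distributive (@quotient_scale G) +%R.
Proof.
move=> a; elim/quotient_projW => p; elim/quotient_projW => q.
by rewrite -quotient_projD !quotient_scaleE scalerDr quotient_projD.
Qed.

Lemma quotient_scaleDl G (x : quotient_mod G) :
  {morph (@quotient_scale G)^~ x : a b / a + b}.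
Proof.
move=> a b; elim/quotient_projW: x => p.
by rewrite !quotient_scaleE scalerDl quotient_projD.
Qed.

HB.instance Definition _ G :=
  GRing.Zmodule_isLmodule.Build A (quotient_mod G) (@quotient_scaleA G)
    (@quotient_scale1 G) (@quotient_scaleDr G) (@quotient_scaleDl G).

End GeneratedIdeal.

Definition is_free_basis (A : nzRingType) (V : lmodType A) (v : seq V) : Prop :=
  (forall x : V, exists c : 'I_(size v) -> A, x = \sum_i c i *: v`_i) /\
  (forall c : 'I_(size v) -> A, \sum_i c i *: v`_i = 0 -> forall i, c i = 0).

Section BorderBasis.
Variables (A : comNzRingType) (n : nat).
Implicit Types (O B : seq 'X_{1..n}) (G : seq {mpoly A[n]}).

Definition quotient_free_on G O : Prop :=
  is_free_basis [seq quotient_proj G 'X_[t] | t <- O].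

Definition border_prebasis O B G : Prop :=
  exists c : 'X_{1..n} -> 'X_{1..n} -> A,
    G =i [seq 'X_[b] - \sum_(t <- O) c t b *: 'X_[t] | b <- B].

Definition border_basis O B G : Prop :=
  border_prebasis O B G /\ quotient_free_on G O.

End BorderBasis.

(* Strict lexicographic order, the variable of index 0 being the largest. *)
Definition lex_lt n (m m' : 'X_{1..n}) : bool :=
  [exists i : 'I_n, (m i < m' i)%N &&
     [forall j : 'I_n, (j < i)%N ==> (m j == m' j)]].

Definition lex_le n (m m' : 'X_{1..n}) : bool := (m == m') || lex_lt m m'.

(* Negative degree-lexicographic order: lower degree first and, within a
   degree, lex-larger first. *)
Definition negdeglex n (m m' : 'X_{1..n}) : bool :=
  (mdeg m < mdeg m')%N || ((mdeg m == mdeg m') && lex_le m' m).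

(* There are n.+1 variables, so that a last variable exists. *)
Definition last_var n : 'X_{1..n.+1} := U_(ord_max)%MM.

Section OrderIdeal.
Variables (n r s : nat) (W : nat -> 'X_{1..n.+1}).
Local Notation monom := 'X_{1..n.+1}.
Implicit Types (m t b : monom) (k : 'I_n.+1).

(* W is only constrained, and only used below, at degrees r, ..., s+1. *)
Record admissible : Prop := Admissible {
  adm_r : (2 <= r)%N;
  adm_s : (r < s)%N;
  adm_deg : forall d, (r <= d <= s.+1)%N -> mdeg (W d) = d;
  adm_top : W s.+1 = (last_var n *+ s.+1)%MM;
  adm_step : forall d, (r <= d < s)%N -> lex_le (W d.+1) (last_var n + W d)%MM;
  adm_W_s : lex_lt (last_var n *+ s)%MM (W s)
}.

Definition in_O m : bool :=
  (mdeg m < r)%N || ((mdeg m <= s.+1)%N && lex_lt m (W (mdeg m))).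

Definition in_border m : bool :=
  ~~ in_O m && [exists k : 'I_n.+1, (U_(k) <= m)%MM && in_O (m - U_(k))%MM].

Definition in_N m : bool := (r <= mdeg m <= s.+1)%N && ~~ in_O m.

(* Elements of O have degree at most s+1, hence those of its border have degree
   at most s+2. *)
Definition monoms : seq monom :=
  sort (@negdeglex n.+1) [seq bmnm bm | bm <- enum {: 'X_{1..n.+1 < s.+3}}].

Definition O_ : seq monom := [seq m <- monoms | in_O m].
Definition border : seq monom := [seq m <- monoms | in_border m].
Definition N_ : seq monom := [seq m <- monoms | in_N m].
Definition N_le_s : seq monom := [seq m <- N_ | (mdeg m <= s)%N].

Definition LM : seq monom :=
  [seq b <- border | (mdeg b <= s)%N &&
     [forall k : 'I_n.+1, (U_(k) <= b)%MM ==> in_O (b - U_(k))%MM]].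
Definition TM : seq monom := [seq t <- O_ | mdeg t == s].

(* [None] is only returned for the monomial 1. *)
Definition lv m : option 'I_n.+1 :=
  [pick k : 'I_n.+1 | (0 < m k)%N &&
     [forall j : 'I_n.+1, (j < k)%N ==> (m j == 0%N)]].
Definition ld m : nat := if lv m is Some k then m k else 0%N.

Definition key k : bool := has (fun m => lv m == Some k) N_le_s.

(* The default 1 is returned when no element of LM has leading variable x_k;
   this does not happen for a key variable. *)
Definition chi k : monom :=
  let L := [seq b <- LM | lv b == Some k] in
  head 0%MM [seq b <- L | all (lex_le b) L].
Definition e_ k : nat := ld (chi k).
Definition mhat k : monom := (chi k - U_(k) *+ e_ k)%MM.

Definition seeds k : seq monom :=
  [seq (t - mhat k)%MM | t <- O_ &
     [&& (mdeg (chi k) <= mdeg t)%N, (mhat k <= t)%MM &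
         (chi k \in LM) ==> (t \notin TM)]].

(* Indices of the indeterminates: pairs (t_i, b_j) for C_{i,j}, and pairs
   (k, t_{k,q}) for theta_{k,q}. *)
Definition C_idx : finType := seq_sub [seq (t, b) | t <- TM, b <- LM].
Definition theta_idx : finType :=
  seq_sub [seq (k, t) | k <- enum key, t <- seeds k].

Variable K : closedFieldType.

Definition coeff_ring : comNzRingType :=
  {mpoly K[#|{: C_idx + theta_idx}|]}.
Local Notation R := coeff_ring.

Definition C_var (i : C_idx) : R := 'X_(enum_rank (inl i : C_idx + theta_idx)).
Definition theta_var (j : theta_idx) : R :=
  'X_(enum_rank (inr j : C_idx + theta_idx)).

Definition Y m : {mpoly R[n.+1]} :=
  if m \in LM then - \sum_(i : C_idx | (ssval i).2 == m) C_var i *: 'X_[(ssval i).1]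
  else 0.

Definition sigma k : {mpoly R[n.+1]} :=
  \sum_(j : theta_idx | (ssval j).1 == k) theta_var j *: 'X_[(ssval j).2].

Definition truncate (p : {mpoly R[n.+1]}) : {mpoly R[n.+1]} :=
  \sum_(m <- msupp p | (mdeg m <= s)%N) p@_m *: 'X_[m].

Definition init_target m : {mpoly R[n.+1]} :=
  if (mdeg m <= s)%N then
    if lv m is Some k then truncate ('X_[m - U_(k) *+ e_ k] * sigma k) else 0
  else 0.

Definition replace_nonO (tau : monom -> {mpoly R[n.+1]}) (p : {mpoly R[n.+1]}) :
    {mpoly R[n.+1]} :=
  \sum_(m' <- msupp p)
    p@_m' *: (if in_O m' then 'X_[m'] else - (Y m' + tau m')).

(* [foldr] treats the list N_ from its last element to its first one; when m is
   reached, [acc] holds the targets of the elements of N_ after m. *)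
Definition target : monom -> {mpoly R[n.+1]} :=
  foldr (fun m acc m' =>
           if m' == m then replace_nonO acc (init_target m) else acc m')
        (fun=> 0) N_.

Definition MGplus : seq {mpoly R[n.+1]} := [seq 'X_[m] + Y m + target m | m <- N_].
Definition MG : seq {mpoly R[n.+1]} := [seq 'X_[b] + Y b + target b | b <- border].

End OrderIdeal.

(* Main.v *)
(* Reduction replaces each monomial m outside O by -(Y m + tau m) and so
   defines a linear projection phi of the polynomials onto the span of O.
   Everything follows once the kernel of phi, which contains MG+, is an ideal.
   Modulo the kernel and terms of degree > s, the elements m + Y m + tau m may
   be traded for Y m + F m with F m = (m / x_k^e_k) (x_k^e_k + sigma_k),
   x_k = lv m.  If x_j <= x_k then x_j F m = F (x_j m).  If x_j > x_k then
   e_j = 1 and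
     x_j F m = F (x_j m) + (m / x_k^e_k) sigma_k (x_j + sigma_j) - sigma_j F m,
   where the middle term is a combination of polynomials F (x_j u), and sigma_j
   only involves variables smaller than x_j: one concludes by descending
   induction on x_j.  The terms Y never interfere, being killed in degree > s and
   attached to minimal elements of N only.  Conversely the span of O plus the
   ideal (MG) is stable under multiplication by variables, hence is everything. *)
Require Import Defs.
From HB Require Import structures.
From mathcomp Require Import all_boot all_order all_algebra.
From mathcomp Require Import boolp zify ring.

Set Implicit Arguments.
Unset Strict Implicit.
Unset Printing Implicit Defensive.

Import GRing.Theory.
Local Open Scope ring_scope.

(** * Lexicographic and negative degree-lexicographic orders *)

Section LexOrder.
Variable n : nat.
Implicit Types m : 'X_{1..n}.

Lemma lex_ltP m m' :
  reflect (exists2 i : 'I_n, (m i < m' i)%N &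
             forall j : 'I_n, (j < i)%N -> m j = m' j) (lex_lt m m').
Proof.
apply: (iffP existsP) => -[i].
  by case/andP=> lt_i /forallP eq_j; exists i => // j ltji; have := eq_j j; rewrite ltji => /eqP.
by move=> lt_i eq_j; exists i; rewrite lt_i; apply/forallP=> j; apply/implyP=> /eq_j/eqP.
Qed.

Lemma lex_lt_irr m : lex_lt m m = false.
Proof. by apply/lex_ltP=> -[i]; rewrite ltnn. Qed.

Lemma lex_lt_trans : transitive (@lex_lt n).
Proof.
move=> y x z /lex_ltP[i lt_i eq_i] /lex_ltP[j lt_j eq_j]; apply/lex_ltP.
case: (ltngtP i j) => [ltij|ltji|/val_inj eqij].
- exists i; first by rewrite -eq_j.
  by move=> k ltki; rewrite eq_i // eq_j // (ltn_trans ltki).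
- exists j; first by rewrite eq_i.
  by move=> k ltkj; rewrite eq_i ?eq_j // (ltn_trans ltkj).
- subst j; exists i; first exact: ltn_trans lt_j.
  by move=> k ltki; rewrite eq_i ?eq_j.
Qed.

Lemma lex_lt_total m m' : [|| m == m', lex_lt m m' | lex_lt m' m].
Proof.
case: eqVneq => //= neq_mm'.
have [i0 diff_i0] : exists i, m i != m' i.
  apply/existsP; apply: contra_neqT neq_mm'; rewrite negb_exists => /forallP eqm.
  by apply/mnmP=> i; apply/eqP; have := eqm i; rewrite negbK.
case: (@arg_minnP _ i0 (fun i => m i != m' i) val diff_i0) => i diff_i min_i.
have eq_j (j : 'I_n) : (j < i)%N -> m j = m' j.
  by move=> ltji; apply/eqP; apply: contraTT ltji; rewrite -leqNgt; apply: min_i.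
apply/orP; case: (ltngtP (m i) (m' i)) diff_i => // lt_i _; [left|right].
all: by apply/lex_ltP; exists i => // j /eq_j.
Qed.

Lemma lex_lt_le m m' : lex_lt m m' = ~~ lex_le m' m.
Proof.
apply/idP/idP => [ltmm'|]; last first.
  rewrite /lex_le negb_or eq_sym; case/andP=> /negbTE neq /negbTE nlt.
  by have := lex_lt_total m m'; rewrite neq nlt orbF.
rewrite /lex_le negb_or; apply/andP; split.
  by apply: contraTneq ltmm' => ->; rewrite lex_lt_irr.
by apply/negP=> /(lex_lt_trans ltmm'); rewrite lex_lt_irr.
Qed.

Lemma lex_le_trans : transitive (@lex_le n).
Proof.
move=> y x z /orP[/eqP->//|ltxy] /orP[/eqP<-|ltyz]; apply/orP; right => //.
exact: lex_lt_trans ltyz.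
Qed.

Lemma lex_le_refl : reflexive (@lex_le n).
Proof. by move=> m; rewrite /lex_le eqxx. Qed.

Lemma lex_le_total : total (@lex_le n).
Proof. by move=> x y; rewrite /lex_le; case/or3P: (lex_lt_total x y) => ->; rewrite ?orbT. Qed.

Lemma lex_le_anti : antisymmetric (@lex_le n).
Proof.
move=> x y /andP[/orP[/eqP//|ltxy]]; apply: contraTeq => _.
by rewrite -lex_lt_le.
Qed.

Lemma lex_leD m m1 m2 : lex_le m1 m2 -> lex_le (m + m1)%MM (m + m2)%MM.
Proof.
case/orP=> [/eqP->|/lex_ltP[i lt_i eq_i]]; first exact: lex_le_refl.
apply/orP; right; apply/lex_ltP; exists i => [|j /eq_i eqj].
  by rewrite !mnmDE ltn_add2l.
by rewrite !mnmDE eqj.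
Qed.

(** A first difference before position k would make [m'] positive there, so the comparison is
    decided at k or later. *)
Lemma lex_le_coord m m' (k : 'I_n) :
  (forall i : 'I_n, (i < k)%N -> m' i = 0%N) -> lex_le m m' -> (m k <= m' k)%N.
Proof.
move=> m'0 /orP[/eqP->//|/lex_ltP[i lt_i eq_i]].
case: (ltngtP i k) => [ltik|ltki|/val_inj<-]; last exact: ltnW.
  by move: lt_i; rewrite m'0.
by rewrite eq_i.
Qed.

Lemma negdeglex_refl : reflexive (@negdeglex n).
Proof. by move=> m; rewrite /negdeglex eqxx lex_le_refl orbT. Qed.

Lemma negdeglex_trans : transitive (@negdeglex n).
Proof.
move=> y x z; rewrite /negdeglex.
case/orP=> [lt1|/andP[/eqP eq1 le1]] /orP[lt2|/andP[/eqP eq2 le2]].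
- by rewrite (ltn_trans lt1).
- by rewrite -eq2 lt1.
- by rewrite eq1 lt2.
- by rewrite eq1 eq2 eqxx (lex_le_trans le2 le1) orbT.
Qed.

Lemma negdeglex_total : total (@negdeglex n).
Proof. by move=> x y; rewrite /negdeglex; case: ltngtP => //= _; rewrite orbC lex_le_total. Qed.

Lemma negdeglex_anti : antisymmetric (@negdeglex n).
Proof.
move=> x y; rewrite /negdeglex; case: ltngtP => //= _.
by rewrite andbC => /lex_le_anti.
Qed.

Lemma mnm_posP m : reflect (exists i, 0 < m i)%N (m != 0%MM).
Proof.
apply: (iffP idP) => [|[i]]; last by apply: contraTneq => ->; rewrite mnm0E.
move=> m0; apply/existsP; apply: contra_neqT m0; rewrite negb_exists => /forallP m0.
by apply/mnmP=> i; have := m0 i; rewrite mnm0E lt0n negbK => /eqP.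
Qed.

Lemma mdeg_pred m (i : 'I_n) : (0 < m i)%N -> mdeg m = (mdeg (m - U_(i))%MM).+1.
Proof.
move=> mi; rewrite -{1}(@submK _ U_(i)%MM m) ?mdegD ?mdeg1 ?addn1 //.
by rewrite lep1mP -lt0n.
Qed.

Lemma mdeg_ge m (i : 'I_n) : (m i <= mdeg m)%N.
Proof. by rewrite mdegE (bigD1 i) //= leq_addr. Qed.

Lemma mdeg_sub m m' : (m <= m')%MM -> mdeg (m' - m)%MM = (mdeg m' - mdeg m)%N.
Proof. by move=> le; rewrite -{2}(submK le) mdegD addnK. Qed.

End LexOrder.

(** * Combinatorics of admissible order ideals *)

Section Combinatorics.
Variables (n r s : nat) (W : nat -> 'X_{1..n.+1}).
Hypothesis admW : admissible r s W.
Local Notation monom := 'X_{1..n.+1}.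
Local Notation inO := (in_O r s W).
Implicit Types (m t b : monom) (i j k : 'I_n.+1).

Let le2r : (2 <= r)%N := adm_r admW.
Let ltrs : (r < s)%N := adm_s admW.

Lemma in_O0 : inO 0%MM.
Proof. by rewrite /in_O mdeg0 (leq_trans _ le2r). Qed.

Lemma notin_O_ge m : ~~ inO m -> (r <= mdeg m)%N.
Proof. by rewrite /in_O negb_or -leqNgt => /andP[]. Qed.

(** [W s.+1] is lex-least in its degree: a strictly smaller monomial would first differ from it at
    x_n, hence be a power of x_n of degree at most s. *)
Lemma in_O_top m : (s < mdeg m)%N -> inO m = false.
Proof.
move=> ltsm; apply/negbTE; rewrite /in_O negb_or -leqNgt (ltnW (ltn_trans ltrs ltsm)) /=.
rewrite negb_and -ltnNge; case: (ltngtP s.+1 (mdeg m)) => //= [|degm]; first by rewrite ltnNge ltsm.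
rewrite -degm (adm_top admW); apply/lex_ltP=> -[i lt_i eq_i].
have i_max : i = ord_max.
  by apply: contraTeq lt_i => /negbTE neq; rewrite mulmnE mnm1E eq_sym neq.
have : (mdeg m <= s)%N.
  rewrite mdegE (bigD1 i) //= big1 ?addn0.
    by move: lt_i; rewrite mulmnE mnm1E i_max eqxx mul1n.
  move=> j neqji; rewrite eq_i ?mulmnE ?mnm1E.
    by rewrite -i_max eq_sym (negbTE neqji).
  by rewrite ltn_neqAle neqji i_max -ltnS ltn_ord.
by rewrite -degm ltnn.
Qed.

Lemma in_O_deg m : inO m -> (mdeg m <= s)%N.
Proof. by apply: contraTT; rewrite -ltnNge => /in_O_top->. Qed.

Lemma notin_O_lex m m' :
  mdeg m' = mdeg m -> lex_le m m' -> ~~ inO m -> ~~ inO m'.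
Proof.
rewrite /in_O => -> le_mm'; rewrite !negb_or !negb_and => /andP[-> /=].
case/orP=> [-> //|]; rewrite !lex_lt_le !negbK => leW; apply/orP; right.
exact: lex_le_trans le_mm'.
Qed.

(** With d the degree of m, x_j m >= x_n m >= x_n W_d >= W_{d+1} when d < s; for d >= s the product
    has degree above s. *)
Lemma notin_O_U m j : ~~ inO m -> ~~ inO (m + U_(j))%MM.
Proof.
move=> mN; have ler := notin_O_ge mN.
have [|ltms] := leqP s (mdeg m); first by move=> lesm; rewrite in_O_top // mdegD mdeg1 addn1 ltnS.
rewrite /in_O mdegD mdeg1 addn1 negb_or -leqNgt (leq_trans ler) //= negb_and lex_lt_le negbK.
apply/orP; right; move: mN; rewrite /in_O negb_or -leqNgt ler /= (leq_trans (ltnW ltms)) //=.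
rewrite lex_lt_le negbK => leW.
have := adm_step admW (d := mdeg m); rewrite ler ltms => /(_ isT) step.
apply: lex_le_trans step _; apply: lex_le_trans (lex_leD _ leW) _.
rewrite addmC /last_var; have [->|neqj] := eqVneq j ord_max; first exact: lex_le_refl.
apply/lex_leD/orP; right; apply/lex_ltP; exists j.
  by rewrite !mnm1E eqxx eq_sym (negbTE neqj).
by move=> i ltij; rewrite !mnm1E -!val_eqE /= (gtn_eqF ltij) gtn_eqF // (leq_trans ltij) // -ltnS.
Qed.

Lemma notin_OD m m' : ~~ inO m -> ~~ inO (m + m')%MM.
Proof.
move=> mN; elim: {m'}(mdeg m') {-2}m' (erefl (mdeg m')) => [|d IH] m' degm'.
  by move/eqP: degm'; rewrite mdeg_eq0 => /eqP->; rewrite addm0.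
have /mnm_posP[i m'i] : m' != 0%MM by rewrite -mdeg_eq0 degm'.
rewrite -(@submK _ U_(i)%MM m') ?lep1mP -?lt0n // addmA notin_O_U // IH //.
by move: degm'; rewrite (mdeg_pred m'i) => -[].
Qed.

Lemma notin_O_le m m' : (m <= m')%MM -> ~~ inO m -> ~~ inO m'.
Proof. by move=> le /notin_OD-/(_ (m' - m)%MM); rewrite addmC submK. Qed.

(** [adm_W_s] puts x_n^s in O, and O is closed under divisors. *)
Lemma in_O_last d : (d <= s)%N -> inO (last_var n *+ d)%MM.
Proof.
move=> leds; have : inO (last_var n *+ s)%MM.
  rewrite /in_O mdegMn mdeg1 mul1n leqnSn /=.
  by rewrite (adm_W_s admW) orbT.
apply: contraTT => dN; apply: notin_O_le dN; apply/mnm_lepP=> i.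
by rewrite !mulmnE leq_mul2l leds orbT.
Qed.

Lemma lvP m k : reflect ((0 < m k)%N /\ forall j, (j < k)%N -> m j = 0%N) (lv m == Some k).
Proof.
rewrite /lv; case: pickP => [i|none].
  case/andP=> mi /forallP m0i.
  apply: (iffP eqP) => [[<-]|[mk m0k]].
    by split=> // j ltji; have := m0i j; rewrite ltji => /eqP.
  congr Some; apply: val_inj; case: (ltngtP i k) => //= [/m0k eq0|ltki].
    by rewrite eq0 in mi.
  by have := m0i k; rewrite ltki => /eqP eq0; rewrite eq0 in mk.
constructor=> -[mk m0k]; have /negP[] := none k; rewrite mk; apply/forallP=> j.
by apply/implyP=> /m0k->.
Qed.

Lemma lv_some m : m != 0%MM -> exists k, lv m = Some k.
Proof.
case/mnm_posP=> i0 mi0; case: (@arg_minnP _ i0 (fun i => 0 < m i)%N val mi0) => i mi min_i.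
exists i; apply/eqP/lvP; split=> // j ltji; apply/eqP; apply: contraTT ltji.
by rewrite -lt0n -leqNgt; apply: min_i.
Qed.

Lemma lv_pos m k : lv m = Some k -> (0 < m k)%N.
Proof. by move/eqP/lvP=> []. Qed.

Lemma lv0 m k j : lv m = Some k -> (j < k)%N -> m j = 0%N.
Proof. by move/eqP/lvP=> [_]; apply. Qed.

Lemma lvI m k : (0 < m k)%N -> (forall j, (j < k)%N -> m j = 0%N) -> lv m = Some k.
Proof. by move=> mk m0; apply/eqP/lvP. Qed.

Lemma ldE m k : lv m = Some k -> ld m = m k.
Proof. by rewrite /ld => ->. Qed.

(** In the degree of m, a monomial divisible by x_j > x_k is lex-larger than m, hence outside O.
    Higher degrees reduce to this one by dividing out variables while keeping a factor x_j. *)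
Lemma notin_O_lv m k j m' : ~~ inO m -> lv m = Some k -> (j < k)%N ->
  (0 < m' j)%N -> (mdeg m <= mdeg m')%N -> ~~ inO m'.
Proof.
move=> mN lvm ltjk; have degm : (2 <= mdeg m)%N := leq_trans le2r (notin_O_ge mN).
elim: {m'}(mdeg m') {-2}m' (erefl (mdeg m')) => [|d IH] m' degm' m'j; first by lia.
rewrite leq_eqVlt => /orP[/eqP degmm'|ltdd].
  have /lv_some[i lvm'] : m' != 0%MM by apply/mnm_posP; exists j.
  have leij : (i <= j)%N by rewrite leqNgt; apply: contraL m'j => /(lv0 lvm')->.
  apply: (@notin_O_lex m) => //.
  apply/orP; right; apply/lex_ltP; exists i.
    by rewrite (lv0 lvm) ?(leq_ltn_trans leij) // (lv_pos lvm').
  move=> i' lti'; rewrite (lv0 lvm') // (lv0 lvm) //.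
  by rewrite (ltn_trans lti') // (leq_ltn_trans leij).
have m'1 : (m' - U_(j) != 0)%MM.
  by rewrite -mdeg_eq0; move: (mdeg_pred m'j); lia.
have [i m'i mj] : exists2 i, (0 < m' i)%N & (0 < (m' - U_(i))%MM j)%N.
  have [eq1|neq1] := eqVneq (m' j) 1%N.
    case/mnm_posP: m'1 => i; rewrite mnmBE mnm1E; case: eqVneq => [<-|neq].
      by rewrite eq1.
    by rewrite subn0 => m'i; exists i => //; rewrite mnmBE mnm1E eq_sym (negbTE neq) subn0.
  by exists j => //; rewrite mnmBE mnm1E eqxx subn_gt0; lia.
apply: notin_O_le (IH _ _ mj _); last by move: (mdeg_pred m'i); lia.
  by apply/mnm_lepP=> l; rewrite mnmBE leq_subr.
by move: (mdeg_pred m'i); lia.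
Qed.

Lemma mem_monoms m : (m \in monoms n s) = (mdeg m < s.+3)%N.
Proof.
rewrite mem_sort; apply/mapP/idP => [[bm _ ->]|ltm]; first exact: bmdeg.
by exists (BMultinom ltm) => //; rewrite mem_enum.
Qed.

Lemma uniq_monoms : uniq (monoms n s).
Proof. by rewrite sort_uniq map_inj_uniq ?enum_uniq //; apply: val_inj. Qed.

Lemma sorted_N : sorted (@negdeglex n.+1) (N_ r s W).
Proof.
apply: sorted_filter; first exact: negdeglex_trans.
exact/sort_sorted/negdeglex_total.
Qed.

Lemma uniq_N : uniq (N_ r s W).
Proof. exact/filter_uniq/uniq_monoms. Qed.

Lemma mem_N m : (m \in N_ r s W) = (mdeg m <= s.+1)%N && ~~ inO m.
Proof.
rewrite mem_filter mem_monoms /in_N; apply/idP/idP; first by case/andP=> /andP[/andP[_ ->] ->].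
by case/andP=> degm mN; rewrite mN degm (notin_O_ge mN) /=; lia.
Qed.

Lemma mem_O m : (m \in O_ r s W) = inO m.
Proof.
rewrite mem_filter mem_monoms; case: (boolP (inO m)) => //= /in_O_deg; lia.
Qed.

Lemma uniq_O : uniq (O_ r s W).
Proof. exact/filter_uniq/uniq_monoms. Qed.

Lemma mem_border m : (m \in border r s W) = in_border r s W m.
Proof.
rewrite mem_filter mem_monoms andb_idr // => /andP[_ /existsP[k /andP[le_km]]].
move/in_O_deg; rewrite mdeg_sub // mdeg1; lia.
Qed.

Lemma border_N : {subset border r s W <= N_ r s W}.
Proof.
move=> m; rewrite mem_border mem_N => /andP[-> /existsP[k /andP[le_km]]].
by move/in_O_deg; rewrite mdeg_sub // mdeg1 andbT; lia.
Qed.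

Lemma in_border_U t k : inO t -> ~~ inO (t + U_(k))%MM -> (t + U_(k))%MM \in border r s W.
Proof.
move=> tO tkN; rewrite mem_border /in_border tkN; apply/existsP; exists k.
by rewrite addmK tO andbT; apply/mnm_lepP=> i; rewrite mnmDE leq_addl.
Qed.

Lemma mem_TM m : (m \in TM r s W) = (mdeg m == s) && inO m.
Proof. by rewrite mem_filter mem_O. Qed.

Lemma mem_LM m : reflect
  [/\ ~~ inO m, (mdeg m <= s)%N & forall k, (0 < m k)%N -> inO (m - U_(k))%MM]
  (m \in LM r s W).
Proof.
rewrite mem_filter mem_border; apply: (iffP idP).
  case/andP=> /andP[degm /forallP mO] /andP[mN _]; split=> // k mk.
  by have := mO k; rewrite lep1mP -lt0n mk.
case=> mN degm mO; rewrite degm /in_border mN /=; apply/andP; split.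
  by apply/forallP=> k; apply/implyP; rewrite lep1mP -lt0n; apply: mO.
have /mnm_posP[k mk] : m != 0%MM by apply: contraNneq mN => ->; apply: in_O0.
by apply/existsP; exists k; rewrite lep1mP -lt0n mk mO.
Qed.

Lemma LM_notin_O m : m \in LM r s W -> ~~ inO m.
Proof. by case/mem_LM. Qed.

Lemma LM_deg m : m \in LM r s W -> (mdeg m <= s)%N.
Proof. by case/mem_LM. Qed.

Lemma notin_LM_U m j : ~~ inO m -> (m + U_(j))%MM \notin LM r s W.
Proof.
move=> mN; apply: contra mN => /mem_LM[_ _ /(_ j)]; rewrite addmK; apply.
by rewrite mnmDE mnm1E eqxx addn1.
Qed.

(** LM consists of the divisibility-minimal monomials outside O of degree at most s, so dividing out
    variables as long as possible ends in LM. *)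
Lemma LM_divisor m : ~~ inO m -> (mdeg m <= s)%N ->
  exists2 b, b \in LM r s W & (b <= m)%MM.
Proof.
elim: {m}(mdeg m) {-2}m (erefl (mdeg m)) => [|d IH] m degm mN degms.
  by move/eqP: degm; rewrite mdeg_eq0 => /eqP m0; rewrite m0 in_O0 in mN.
have [mLM|] := boolP (m \in LM r s W); first by exists m => //; apply: lepm_refl.
have [/existsP[k /andP[mk mkN]] _|/existsPn none] :=
    boolP [exists k, (0 < m k)%N && ~~ inO (m - U_(k))%MM].
  have degk := mdeg_pred mk.
  have [||b bLM le_b] := IH _ _ mkN; [by lia | by lia |].
  exists b => //; apply: lepm_trans le_b _.
  by apply/mnm_lepP=> l; rewrite mnmBE leq_subr.
case/mem_LM; split=> // k mk.
by have := none k; rewrite mk negbK.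
Qed.

(** The pure power is lex-largest among the monomials of its degree with leading variable x_k. *)
Lemma notin_O_pow m k : ~~ inO m -> lv m = Some k -> ~~ inO (U_(k) *+ mdeg m)%MM.
Proof.
move=> mN lvm; apply: notin_O_lex mN; first by rewrite mdegMn mdeg1 mul1n.
rewrite /lex_le; case: eqVneq => //= neq; apply/lex_ltP; exists k; last first.
  by move=> j ltjk; rewrite (lv0 lvm) // mulmnE mnm1E -val_eqE /= (gtn_eqF ltjk).
rewrite mulmnE mnm1E eqxx mul1n ltn_neqAle mdeg_ge andbT.
apply: contra neq => /eqP eq_mk.
have m0 : (\sum_(i | i != k) m i = 0)%N.
  by move: (mdegE m); rewrite (bigD1 k) //= -eq_mk; lia.
apply/eqP/mnmP=> j; rewrite mulmnE mnm1E eq_sym; case: eqVneq => [->|neqj].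
  by rewrite mul1n eq_mk.
by move/eqP: m0; rewrite sum_nat_eq0 => /forallP/(_ j); rewrite neqj => /eqP.
Qed.

(** * Key variables and key monomials *)

Lemma keyP k : reflect (exists m, [/\ ~~ inO m, (mdeg m <= s)%N & lv m = Some k]) (key r s W k).
Proof.
apply: (iffP hasP) => [[m]|[m [mN degm lvm]]].
  by rewrite mem_filter mem_N => /and3P[degm _ mN] /eqP lvm; exists m.
exists m; last by rewrite lvm.
by rewrite mem_filter mem_N degm mN (leqW degm).
Qed.

(** A divisor in LM of a pure power of x_k is again a power of x_k, and it is not 1 because 1 lies
    in O. *)
Lemma LM_lv k : key r s W k -> exists2 b, b \in LM r s W & lv b = Some k.
Proof.
case/keyP=> m [mN degm lvm].
have [||b bLM le_b] := @LM_divisor (U_(k) *+ mdeg m)%MM.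
- exact: notin_O_pow.
- by rewrite mdegMn mdeg1 mul1n.
exists b => //; have b0 j : j != k -> b j = 0%N.
  move=> neqj; have /mnm_lepP/(_ j) := le_b.
  by rewrite mulmnE mnm1E eq_sym (negbTE neqj) leqn0 => /eqP.
have /mnm_posP[i bi] : b != 0%MM.
  by apply: contraTneq bLM => ->; apply/mem_LM=> -[]; rewrite in_O0.
have eqi : i = k by apply: contraTeq bi => /b0->.
rewrite eqi in bi; apply: lvI => // j ltjk; apply: b0.
by rewrite -val_eqE /= (ltn_eqF ltjk).
Qed.

Lemma lex_min_exists (L : seq monom) : L != [::] ->
  exists2 b, b \in L & all (lex_le b) L.
Proof.
elim: L => // a [|a' L] IH _.
  by exists a; rewrite ?mem_seq1 //= lex_le_refl.
have [//|b bL minb] := IH.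
have [le_ab|le_ba] := orP (lex_le_total a b).
  exists a; first exact: mem_head.
  apply/allP=> x; rewrite in_cons => /predU1P[->|/(allP minb)]; first exact: lex_le_refl.
  exact: lex_le_trans.
exists b; first by rewrite in_cons bL orbT.
by apply/allP=> x; rewrite in_cons => /predU1P[-> //|/(allP minb)].
Qed.

(** For a key variable neither filter in [chi] is empty, so the default 1 is not reached. *)
Lemma chiP k : key r s W k ->
  [/\ chi r s W k \in LM r s W, lv (chi r s W k) = Some k &
      forall b, b \in LM r s W -> lv b = Some k -> lex_le (chi r s W k) b].
Proof.
move=> /LM_lv[b0 b0LM lvb0]; rewrite /chi.
set L := [seq b <- LM r s W | lv b == Some k].
have b0L : b0 \in L by rewrite mem_filter lvb0 eqxx.
have [|b bL minb] := @lex_min_exists L; first by case: L b0L.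
set h := head _ _; have : h \in [seq b <- L | all (lex_le b) L].
  have : b \in [seq b <- L | all (lex_le b) L] by rewrite mem_filter minb.
  by rewrite /h; case: [seq _ <- _ | _] => //= a l _; apply: mem_head.
rewrite mem_filter mem_filter => /and3P[/allP minh /eqP lvh hLM]; split=> // b' b'LM lvb'.
by apply: minh; rewrite mem_filter lvb' eqxx.
Qed.

Local Notation e := (e_ r s W).
Local Notation mhat := (mhat r s W).
Local Notation chi := (chi r s W).

Lemma e_chi k : key r s W k -> e k = chi k k.
Proof. by case/chiP=> _ lvc _; rewrite /e_ (ldE lvc). Qed.

Lemma e_pos k : key r s W k -> (0 < e k)%N.
Proof. by move=> keyk; rewrite e_chi //; case/chiP: keyk => _ /lv_pos. Qed.

Lemma e_LM_le k b : key r s W k -> b \in LM r s W -> lv b = Some k -> (e k <= b k)%N.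
Proof.
move=> keyk bLM lvb; rewrite e_chi //; case/chiP: keyk => _ _ /(_ b bLM lvb).
by apply: lex_le_coord => i; apply: lv0.
Qed.

(* Only the last key variable can have a key monomial with exponent above 1. *)
Lemma key_lt m k j : ~~ inO m -> (mdeg m <= s)%N -> lv m = Some k -> (j < k)%N ->
  key r s W j /\ e j = 1%N.
Proof.
move=> mN degm lvm ltjk; have gem : (2 <= mdeg m)%N := leq_trans le2r (notin_O_ge mN).
(* This monomial contains x_j > x_k, so [notin_O_lv] puts it outside O; all its divisors have
   x_j-exponent at most 1. *)
pose m' := (U_(j) + last_var n *+ (mdeg m).-1)%MM.
have neqj : (ord_max == j :> 'I_n.+1) = false.
  by apply/negbTE; rewrite -val_eqE /=; have := ltn_ord k; lia.
have m'j : m' j = 1%N by rewrite mnmDE mulmnE !mnm1E eqxx neqj addn0.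
have m'i i : i != j -> i != ord_max -> m' i = 0%N.
  by move=> n1 n2; rewrite mnmDE mulmnE !mnm1E eq_sym (negbTE n1) eq_sym (negbTE n2).
have degm' : mdeg m' = mdeg m by rewrite mdegD mdegMn !mdeg1; lia.
have m'N : ~~ inO m' by apply: notin_O_lv mN lvm ltjk _ _; rewrite ?m'j ?degm'.
have lv_j b : (b <= m')%MM -> (0 < b j)%N -> lv b = Some j.
  move=> /mnm_lepP leb bj; apply: lvI => // i ltij; apply/eqP; rewrite -leqn0.
  rewrite (leq_trans (leb i)) // m'i // -val_eqE /=; first by rewrite (ltn_eqF ltij).
  by have := ltn_ord k; lia.
have keyj : key r s W j.
  by apply/keyP; exists m'; split; rewrite ?degm' // lv_j ?lepm_refl ?m'j.
split=> //; have [|b bLM leb] := LM_divisor m'N; first by rewrite degm'.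
(* Without x_j, the divisor b would be a power of x_n of degree at most s, hence in O. *)
have bj : (0 < b j)%N.
  rewrite lt0n; apply: contra (LM_notin_O bLM) => /eqP bj0.
  have -> : b = (last_var n *+ (b ord_max))%MM.
    apply/mnmP=> i; rewrite mulmnE mnm1E eq_sym; case: eqVneq => [->|ni].
      by rewrite mul1n.
    have [->|nj] := eqVneq i j; first by rewrite bj0.
    by apply/eqP; rewrite -leqn0 -(m'i i) //; apply/mnm_lepP.
  by apply: in_O_last; apply: leq_trans (mdeg_ge _ _) (LM_deg bLM).
have := e_LM_le keyj bLM (lv_j _ leb bj); have := e_pos keyj.
by have /mnm_lepP/(_ j) := leb; rewrite m'j; lia.
Qed.

(** A divisor b of m in LM has leading variable x_k, where e_k is the least exponent, or a smaller
    one; in the latter case [key_lt], applied to b, gives e_k = 1. *)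
Lemma e_le m k : ~~ inO m -> (mdeg m <= s)%N -> lv m = Some k -> (e k <= m k)%N.
Proof.
move=> mN degm lvm; have keyk : key r s W k by apply/keyP; exists m.
have [b bLM leb] := LM_divisor mN degm.
have /lv_some[i lvb] : b != 0%MM.
  by apply: contraTneq bLM => ->; apply/mem_LM=> -[]; rewrite in_O0.
have lekk : (b k <= m k)%N by apply/mnm_lepP.
case: (ltngtP i k) => [ltik|ltki|/val_inj eqi].
- have /mnm_lepP/(_ i) := leb; rewrite (lv0 lvm) // leqNgt.
  by rewrite (lv_pos lvb).
- have [_ ->] := key_lt (LM_notin_O bLM) (LM_deg bLM) lvb ltki.
  exact: lv_pos lvm.
- by apply: leq_trans lekk; rewrite eqi in lvb; apply: e_LM_le.
Qed.

Lemma chiE k : (U_(k) *+ e k <= chi k)%MM -> chi k = (U_(k) *+ e k + mhat k)%MM.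
Proof. by move=> le; rewrite addmC submK. Qed.

Lemma mulU_le m k a : (U_(k) *+ a <= m)%MM = (a <= m k)%N.
Proof.
apply/mnm_lepP/idP => [/(_ k)|lea i]; first by rewrite mulmnE mnm1E eqxx mul1n.
by rewrite mulmnE mnm1E; case: eqVneq => [<-|//]; rewrite mul1n.
Qed.

(** * Degree and support of the seed monomials *)

Section Seeds.
Variables (k : 'I_n.+1) (t' : monom).
Hypotheses (keyk : key r s W k) (t'S : t' \in seeds r s W k).

Let chi_dec : chi k = (U_(k) *+ e k + mhat k)%MM.
Proof. by apply: chiE; rewrite mulU_le e_chi. Qed.

Let seedP : exists t, [/\ inO t, (mdeg (chi k) <= mdeg t)%N, (mhat k <= t)%MM &
  t' = (t - mhat k)%MM].
Proof.
case/mapP: t'S => t; rewrite mem_filter mem_O => /andP[/and3P[? ? _] ?] ->.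
by exists t.
Qed.

Lemma seed_deg : (e k <= mdeg t')%N.
Proof.
have [t [_ led le ->]] := seedP; rewrite mdeg_sub //.
by move: led; rewrite chi_dec mdegD mdegMn mdeg1 mul1n; lia.
Qed.

(** By [notin_O_lv], a monomial of O of degree at least that of [chi k] contains no variable larger
    than x_k. *)
Lemma seed_lt i : (i < k)%N -> t' i = 0%N.
Proof.
move=> ltik; have [t [tO led le ->]] := seedP; rewrite mnmBE.
suff -> : t i = 0%N by [].
apply/eqP; apply: contraTT tO; rewrite -lt0n => ti.
have [cLM lvc _] := chiP keyk.
exact: notin_O_lv (LM_notin_O cLM) lvc ltik ti led.
Qed.

(** Otherwise the product of t' and [mhat k], which lies in O, would be a multiple of [chi k]. *)
Lemma seed_key : (t' k < e k)%N.
Proof.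
have [t [tO led le t'E]] := seedP; rewrite ltnNge; apply: contraL tO => lee.
have [/LM_notin_O cN _ _] := chiP keyk; apply: notin_O_le cN.
rewrite chi_dec -(submK le) -t'E; apply/mnm_lepP=> i.
by rewrite !mnmDE leq_add2r; apply/mnm_lepP; rewrite mulU_le.
Qed.

Lemma seed_mul_deg m : (e k <= m k)%N -> (mdeg m <= mdeg (m - U_(k) *+ e k + t')%MM)%N.
Proof.
move=> lee; rewrite mdegD mdeg_sub ?mulU_le // mdegMn mdeg1 mul1n.
by have := seed_deg; have := mdeg_ge m k; lia.
Qed.

(** Trading x_k^e_k for a seed does not lower the degree, and it lowers the exponent of x_k without
    introducing larger variables. Hence the recursion for the targets only calls on later
    monomials. *)
Lemma seed_mul_after m : lv m = Some k -> (e k <= m k)%N ->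
  negdeglex m (m - U_(k) *+ e k + t')%MM && (m != m - U_(k) *+ e k + t')%MM.
Proof.
move=> lvm lee; set u := (_ + t')%MM.
have ltk : (u k < m k)%N.
  by rewrite mnmDE mnmBE mulmnE mnm1E eqxx mul1n; have := seed_key; lia.
rewrite andbC; apply/andP; split; first by apply: contraTneq ltk => <-; rewrite ltnn.
rewrite /negdeglex; have := seed_mul_deg lee; rewrite leq_eqVlt => /orP[/eqP eqd|-> //].
apply/orP; right; rewrite {1}eqd eqxx; apply/orP; right; apply/lex_ltP; exists k => // j ltjk.
by rewrite mnmDE mnmBE (lv0 lvm) // seed_lt.
Qed.

End Seeds.

(** Induction from the last element of N to the first, on the number of elements at or after m. *)
Lemma N_rect (P : monom -> Prop) :
  (forall m, m \in N_ r s W ->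
     (forall m', m' \in N_ r s W -> negdeglex m m' -> m != m' -> P m') -> P m) ->
  forall m, m \in N_ r s W -> P m.
Proof.
move=> step m; have [c] := ubnP (count (@negdeglex _ m) (N_ r s W)).
elim: c m => // c IH m; rewrite ltnS => lec mN; apply: step => // m' m'N after neq.
apply: IH => //; apply: leq_trans lec.
rewrite -!size_filter.
(* By transitivity, what lies at or after m' also lies after m, whereas m does not lie at or after
   m'; so the count drops. *)
have : subseq (m :: [seq x <- N_ r s W | negdeglex m' x])
              (m :: [seq x <- [seq x <- N_ r s W | negdeglex m x] | negdeglex m' x]).
  rewrite -filter_predI /= eqxx.
  suff -> : [seq x <- N_ r s W | negdeglex m' x] =
    [seq x <- N_ r s W | predI (negdeglex m') (negdeglex m) x] by apply: subseq_refl.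
  apply: eq_filter => x /=; case: (boolP (negdeglex m' x)) => //= /(negdeglex_trans after)->.
  by [].
move/size_subseq => /= le1; apply: leq_trans le1 _.
set L := [seq x <- N_ r s W | negdeglex m x].
have mL : m \in L by rewrite mem_filter negdeglex_refl.
rewrite size_filter -(count_predC (negdeglex m') L) -addn1 leq_add2l -has_count.
apply/hasP; exists m => //=; apply: contra neq => after'.
by apply/eqP/negdeglex_anti; rewrite after after'.
Qed.

End Combinatorics.

(** * Linear extension of a map given on monomials *)

HB.lock Definition lin_ext (n : nat) (A : comNzRingType) (V : lmodType A)
    (g : 'X_{1..n} -> V) (p : {mpoly A[n]}) : V :=
  \sum_(m <- msupp p) p@_m *: g m.

Section LinearExtension.
Variables (n : nat) (A : comNzRingType) (V : lmodType A) (g : 'X_{1..n} -> V).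
Implicit Types p q : {mpoly A[n]}.

Lemma lin_extE (S : seq 'X_{1..n}) p : uniq S -> {subset msupp p <= S} ->
  lin_ext g p = \sum_(m <- S) p@_m *: g m.
Proof.
move=> uS sub; rewrite lin_ext.unlock [RHS](bigID (mem (msupp p))) /=.
rewrite [X in _ + X]big1 ?addr0; last first.
  by move=> m; rewrite -mcoeff_eq0 => /eqP->; rewrite scale0r.
rewrite -[RHS]big_filter; apply/perm_big/uniq_perm; rewrite ?msupp_uniq ?filter_uniq //.
by move=> m; rewrite mem_filter; case: (boolP (m \in msupp p)) => // /sub->.
Qed.

Lemma lin_ext_is_linear : linear (lin_ext g).
Proof.
move=> a p q; pose S := undup (msupp (a *: p + q) ++ msupp p ++ msupp q).
have S1 : {subset msupp (a *: p + q) <= S} by move=> m; rewrite mem_undup !mem_cat => ->.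
have S2 : {subset msupp p <= S} by move=> m; rewrite mem_undup !mem_cat => ->; rewrite orbT.
have S3 : {subset msupp q <= S} by move=> m; rewrite mem_undup !mem_cat => ->; rewrite !orbT.
rewrite !(@lin_extE S) ?undup_uniq //.
rewrite scaler_sumr -big_split /=; apply: eq_bigr => m _.
by rewrite mcoeffD mcoeffZ scalerDl scalerA.
Qed.

HB.instance Definition _ := GRing.isLinear.Build A {mpoly A[n]} V _ (lin_ext g) lin_ext_is_linear.

Lemma lin_extX m : lin_ext g 'X_[m] = g m.
Proof. by rewrite lin_ext.unlock msuppX big_seq1 mcoeffX eqxx scale1r. Qed.

End LinearExtension.

(** * The reduction map [phi] and the recursion for the targets *)

Section NormalForm.
Variables (n r s : nat) (W : nat -> 'X_{1..n.+1}).
Hypothesis admW : admissible r s W.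
Variable K : closedFieldType.
Local Notation monom := 'X_{1..n.+1}.
Local Notation inO := (in_O r s W).
Local Notation R := (coeff_ring r s W K).
Local Notation P := {mpoly R[n.+1]}.
Local Notation e := (e_ r s W).
Local Notation sigma := (sigma r s W K).
Local Notation Y := (Y r s W K).
Local Notation target := (target r s W K).
Local Notation key := (key r s W).
Implicit Types (m t b : monom) (i j k : 'I_n.+1) (p q : P).

(** For x_k the leading variable of m, this is the initial target before truncation, a difference
    that [phi] does not see ([phi_truncate]). *)
Definition shifted_sigma m k : P := 'X_[m - U_(k) *+ e k] * sigma k.

Lemma theta_seed k (j : theta_idx r s W) :
  (ssval j).1 == k -> key k /\ (ssval j).2 \in seeds r s W k.
Proof.
move/eqP=> <-; have := ssvalP j; case/allpairsPdep=> k' [t [keyk tS ->]] /=.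
by rewrite mem_enum in keyk.
Qed.

Lemma shifted_sigmaE m k : shifted_sigma m k =
  \sum_(j : theta_idx r s W | (ssval j).1 == k)
     theta_var K j *: 'X_[m - U_(k) *+ e k + (ssval j).2].
Proof.
rewrite /shifted_sigma mulr_sumr; apply: eq_bigr => j _.
by rewrite mpolyXD scalerAr.
Qed.

Lemma msupp_shifted_sigma m k m' : m' \in msupp (shifted_sigma m k) ->
  exists2 t, t \in seeds r s W k & m' = (m - U_(k) *+ e k + t)%MM.
Proof.
rewrite mcoeff_msupp shifted_sigmaE raddf_sum /=; apply: contraPP => none.
rewrite big1 ?eqxx // => j eqj; have [_ tS] := theta_seed eqj.
rewrite mcoeffZ mcoeffX; case: eqVneq => [eqm|_]; last by rewrite mulr0.
by case: none; exists (ssval j).2.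
Qed.

Lemma msupp_truncate p m : m \in msupp (truncate p) -> m \in msupp p /\ (mdeg m <= s)%N.
Proof.
rewrite mcoeff_msupp /truncate raddf_sum /=; apply: contraPP => none.
rewrite big_seq_cond big1 ?eqxx // => m' /andP[m'p degm'].
rewrite mcoeffZ mcoeffX; case: eqVneq => [eqm|_]; last by rewrite mulr0.
by case: none; rewrite -eqm.
Qed.

Lemma init_targetE m k : (mdeg m <= s)%N -> lv m = Some k ->
  init_target r s W K m = truncate (shifted_sigma m k).
Proof. by rewrite /init_target => -> ->. Qed.

Lemma init_target_high m : (s < mdeg m)%N -> init_target r s W K m = 0.
Proof. by move=> degm; rewrite /init_target [(mdeg m <= s)%N]leqNgt degm. Qed.

Lemma init_target_after m m' : ~~ inO m -> m' \in msupp (init_target r s W K m) ->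
  negdeglex m m' && (m != m').
Proof.
move=> mN; case: (leqP (mdeg m) s) => [degm|/init_target_high->]; last by rewrite msupp0.
have /lv_some[k lvm] : m != 0%MM by apply: contraNneq mN => ->; apply: in_O0.
rewrite (init_targetE degm lvm) => /msupp_truncate[/msupp_shifted_sigma[t tS ->] _].
apply: seed_mul_after => //; last exact: e_le.
by apply/keyP => //; exists m.
Qed.

Definition step m (acc : monom -> P) := fun m' : monom =>
  if m' == m then replace_nonO acc (init_target r s W K m) else acc m'.

Lemma stepE m acc m' :
  step m acc m' = if m' == m then replace_nonO acc (init_target r s W K m) else acc m'.
Proof. by []. Qed.

Lemma foldr_target_notin (L : seq monom) m : m \notin L -> foldr step (fun=> 0) L m = 0.
Proof.
by elim: L => //= a L IH; rewrite in_cons negb_or stepE => /andP[/negbTE-> /IH].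
Qed.

(** When the fold reaches m, it has already settled every monomial after m, and only such monomials
    occur in the initial target of m. The values may therefore be read off the completed
    function. *)
Lemma foldr_target_in (L : seq monom) m : sorted (@negdeglex _) L -> uniq L ->
  {in L, forall m, ~~ inO m} -> m \in L ->
  foldr step (fun=> 0) L m = replace_nonO (foldr step (fun=> 0) L) (init_target r s W K m).
Proof.
elim: L => //= a L IH path_L /andP[aL uL] LN.
have minL : all (negdeglex a) L by apply: order_path_min path_L; apply: negdeglex_trans.
(* Updating the value at a is harmless: a cannot occur in the initial target of a monomial x at or
   after a. *)
have eq_acc x : ~~ inO x -> negdeglex a x -> 
    replace_nonO (step a (foldr step (fun=> 0) L)) (init_target r s W K x) =
    replace_nonO (foldr step (fun=> 0) L) (init_target r s W K x).
  move=> xN le_ax; apply: eq_big_seq => m' /(init_target_after xN)/andP[le_xm' neq].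
  have /negbTE neqa : m' != a.
    by apply: contraNneq neq => eqm'; apply/eqP/negdeglex_anti; rewrite le_xm' eqm' le_ax.
  by rewrite stepE neqa.
rewrite in_cons; case: eqVneq => [-> _|neq /= mL].
  by rewrite [LHS]stepE eqxx eq_acc ?negdeglex_refl ?LN ?mem_head.
rewrite [LHS]stepE (negbTE neq) eq_acc; first last.
- exact: (allP minL).
- by apply: LN; rewrite in_cons mL orbT.
apply: IH => //; first exact: path_sorted path_L.
by move=> x xL; apply: LN; rewrite in_cons xL orbT.
Qed.

Definition nf m : P := if inO m then 'X_[m] else - (Y m + target m).

Local Notation phi := (lin_ext nf).

Lemma replace_nonOE p : replace_nonO target p = phi p.
Proof. by rewrite lin_ext.unlock. Qed.

Lemma phi_sum (I : Type) (l : seq I) (D : pred I) (G : I -> P) :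
  phi (\sum_(i <- l | D i) G i) = \sum_(i <- l | D i) phi (G i).
Proof. exact: linear_sum. Qed.

Lemma target_rec m : m \in N_ r s W -> target m = phi (init_target r s W K m).
Proof.
move=> mN; rewrite -replace_nonOE; apply: foldr_target_in => //; first exact: sorted_N.
  exact: uniq_N.
by move=> x; rewrite mem_N // => /andP[].
Qed.

Lemma Y0 m : m \notin LM r s W -> Y m = 0.
Proof. by rewrite /Defs.Y => /negbTE->. Qed.

Lemma nf_O m : inO m -> nf m = 'X_[m].
Proof. by rewrite /nf => ->. Qed.

Lemma nf_notin_O m : ~~ inO m -> nf m = - (Y m + target m).
Proof. by rewrite /nf => /negbTE->. Qed.

(** LM stops at degree s, initial targets vanish in degree s+1, and beyond that m is not in N, so
    the fold returns its default 0. *)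
Lemma nf_high m : (s < mdeg m)%N -> nf m = 0.
Proof.
move=> degm; rewrite nf_notin_O ?in_O_top // Y0; last first.
  by apply: contraL degm => /(LM_deg admW); rewrite -leqNgt.
have [mN|mN] := boolP (m \in N_ r s W).
  by rewrite target_rec // init_target_high // linear0 addr0 oppr0.
by rewrite add0r /Defs.target foldr_target_notin // oppr0.
Qed.

Lemma phi_truncate p : phi (truncate p) = phi p.
Proof.
rewrite {2}[p]mpolyE !linear_sum /= big_mkcond /=; apply: eq_bigr => m _.
by case: leqP => // degm; rewrite linearZ /= lin_extX nf_high // scaler0.
Qed.

Lemma phi_shifted_sigma m k : phi (shifted_sigma m k) =
  \sum_(j : theta_idx r s W | (ssval j).1 == k)
     theta_var K j *: nf (m - U_(k) *+ e k + (ssval j).2)%MM.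
Proof.
by rewrite shifted_sigmaE linear_sum; apply: eq_bigr => j _; rewrite linearZ /= lin_extX.
Qed.

Lemma target_low m k : ~~ inO m -> (mdeg m <= s)%N -> lv m = Some k ->
  target m = phi (shifted_sigma m k).
Proof.
move=> mN degm lvm; rewrite target_rec; first by rewrite (init_targetE degm lvm) phi_truncate.
by rewrite mem_N // mN leqW.
Qed.

Definition spanO p := forall m, ~~ inO m -> p@_m = 0.

Lemma spanO_phi p : spanO p -> phi p = p.
Proof.
move=> pO; rewrite {2}[p]mpolyE lin_ext.unlock; apply: eq_bigr => m _.
by case: (boolP (inO m)) => [/nf_O->//|/pO->]; rewrite !scale0r.
Qed.

Lemma spanOX t : inO t -> spanO 'X_[t].
Proof. by move=> tO m mN; rewrite mcoeffX; case: eqP mN => // <-; rewrite tO. Qed.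

Lemma spanO_lin_ext (g : monom -> P) p : (forall m, spanO (g m)) -> spanO (lin_ext g p).
Proof.
by move=> gO m mN; rewrite lin_ext.unlock raddf_sum /= big1 // => m' _; rewrite mcoeffZ gO ?mulr0.
Qed.

Lemma TM_of_idx (i : C_idx r s W) : mdeg (ssval i).1 = s /\ inO (ssval i).1.
Proof.
have := ssvalP i; case/allpairsP=> -[t b] /= [tTM _ ->] /=.
by move: tTM; rewrite mem_TM // => /andP[/eqP].
Qed.

Lemma spanO_Y m : spanO (Y m).
Proof.
move=> m' m'N; rewrite /Defs.Y; case: ifP => _; last exact: mcoeff0.
rewrite mcoeffN raddf_sum /= big1 ?oppr0 // => i _; have [_ tO] := TM_of_idx i.
by rewrite mcoeffZ spanOX ?mulr0.
Qed.

(** The terms of [Y m] have degree s, so multiplying by u moves them to degrees that [phi] kills. *)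
Lemma phi_mul_Y u m : u != 0%MM -> phi ('X_[u] * Y m) = 0.
Proof.
rewrite -mdeg_eq0 => u0; rewrite /Defs.Y; case: ifP => _; last by rewrite mulr0 linear0.
rewrite mulrN mulr_sumr linearN /= phi_sum big1 ?oppr0 // => i _; have [degt _] := TM_of_idx i.
by rewrite -scalerAr -mpolyXD linearZ /= lin_extX nf_high ?scaler0 // mdegD degt; lia.
Qed.

(** Induction from the end of N: outside O, [nf m] is built from [Y m], whose terms lie in TM, and
    from [nf u] for monomials u after m. *)
Lemma spanO_nf m : spanO (nf m).
Proof.
case: (boolP (inO m)) => [mO|mN]; first by rewrite nf_O //; apply: spanOX.
case: (leqP (mdeg m) s) => [degm|/nf_high->]; last by move=> *; apply: mcoeff0.
have : m \in N_ r s W by rewrite mem_N // mN leqW.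
move: m {mN degm}; apply: (N_rect (s := s)) => m mN IH m' m'N.
have /andP[_ mO] : (mdeg m <= s.+1)%N && ~~ inO m by rewrite -mem_N.
rewrite nf_notin_O // mcoeffN mcoeffD spanO_Y // add0r target_rec //.
rewrite lin_ext.unlock raddf_sum big_seq big1 ?oppr0 //= => u u_init; rewrite mcoeffZ.
suff -> : (nf u)@_m' = 0 by rewrite mulr0.
case: (boolP (inO u)) => [uO|uN]; first by rewrite nf_O //; apply: spanOX.
case: (leqP (mdeg u) s) => [degu|/nf_high->]; last exact: mcoeff0.
have /andP[after neq] := init_target_after mO u_init.
by apply: IH => //; rewrite mem_N // uN leqW.
Qed.

Lemma spanO_phiW p : spanO (phi p).
Proof. exact/spanO_lin_ext/spanO_nf. Qed.

Lemma phi_nf m : phi (nf m) = nf m.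
Proof. exact/spanO_phi/spanO_nf. Qed.

(** * Stability of the kernel of [phi] under the variables *)

Definition F k m : P := 'X_[m] + shifted_sigma m k.

(** Up to degree s this is the recursion for [target]. Above it every term vanishes, since seeds do
    not lower the degree. *)
Lemma phi_F k m : ~~ inO m -> lv m = Some k -> key k -> (e k <= m k)%N ->
  phi (F k m + Y m) = 0.
Proof.
move=> mN lvm keyk lee; rewrite !linearD /= lin_extX (spanO_phi (spanO_Y m)).
case: (leqP (mdeg m) s) => [degm|degm].
  by rewrite nf_notin_O // (target_low mN degm lvm); ring.
rewrite nf_high // add0r Y0 ?addr0; last by apply: contraL degm => /(LM_deg admW); rewrite -leqNgt.
rewrite phi_shifted_sigma big1 // => j /theta_seed[_ tS].
by rewrite nf_high ?scaler0 // (leq_trans degm) // seed_mul_deg.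
Qed.

Definition stable j := forall p, phi p = 0 -> phi ('X_j * p) = 0.

(** If [phi p = 0], then p = p - [phi p] is a combination of the elements m - [nf m]. *)
Lemma stable_nf j : (forall m, phi ('X_j * ('X_[m] - nf m)) = 0) -> stable j.
Proof.
move=> stab p p0; have -> : p = \sum_(m <- msupp p) p@_m *: ('X_[m] - nf m).
  under eq_bigr do rewrite scalerBr.
  move: p0; rewrite lin_ext.unlock => p0.
  by rewrite sumrB -mpolyE [X in _ - X]p0 subr0.
rewrite mulr_sumr phi_sum big1 // => m _; rewrite -scalerAr linearZ /= stab.
exact: scaler0.
Qed.

(** Stability is assumed only for the variables of m, because within [stable_var] it is known only
    for the smaller variables. *)
Lemma stable_monom m : (forall i, (0 < m i)%N -> stable i) ->
  forall p, phi p = 0 -> phi ('X_[m] * p) = 0.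
Proof.
elim: {m}(mdeg m) {-2}m (erefl (mdeg m)) => [|d IH] m degm stab p p0.
  by move/eqP: degm; rewrite mdeg_eq0 => /eqP->; rewrite mpolyX0 mul1r.
have /mnm_posP[i mi] : m != 0%MM by rewrite -mdeg_eq0 degm.
rewrite -(@submK _ U_(i)%MM m) ?lep1mP -?lt0n // addmC mpolyXD -mulrA.
apply: (stab) => //; apply: IH => //; first by move: degm; rewrite (mdeg_pred mi) => -[].
by move=> l; rewrite mnmBE => ml; apply: stab; apply: leq_trans ml (leq_subr _ _).
Qed.

(** The outer induction runs over the variables from x_n upwards and handles multiplication by seeds
    of x_j; the inner one runs over m from the end of N and handles the seed part of m - [nf m]. *)
Lemma stable_var j : stable j.
Proof.
have [d] := ubnP (n.+1 - j)%N; elim: d j => // d IHd j ltjd.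
have {IHd ltjd} stab i : (j < i)%N -> stable i.
  by move=> ltji; apply: IHd; have := ltn_ord i; lia.
apply: stable_nf => m; case: (boolP (inO m)) => [/nf_O->|mN].
  by rewrite subrr mulr0 linear0.
case: (leqP (mdeg m) s) => [degm|degm]; last first.
  by rewrite (nf_high degm) subr0 -mpolyXD lin_extX nf_high // mdegD (leq_trans degm) // leq_addl.
have : m \in N_ r s W by rewrite mem_N // mN leqW.
move: m {mN degm}; apply: (N_rect (s := s)) => m mNN IH.
have /andP[degm1 mN] : (mdeg m <= s.+1)%N && ~~ inO m by rewrite -mem_N.
case: (leqP (mdeg m) s) => [degm|degm]; last first.
  by rewrite (nf_high degm) subr0 -mpolyXD lin_extX nf_high // mdegD (leq_trans degm) // leq_addl.
have /(lv_some)[k lvm] : m != 0%MM by apply: contraNneq mN => ->; apply: in_O0 admW.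
have keyk : key k by apply/keyP => //; exists m.
have lee : (e k <= m k)%N by apply: e_le.
(* The last bracket is a combination of elements u - [nf u] with u after m, covered by the inner
   induction. *)
have -> : 'X_[m] - nf m = (F k m + Y m) - (shifted_sigma m k - phi (shifted_sigma m k)).
  rewrite nf_notin_O // (target_low mN degm lvm) /F opprK opprB.
  ring.
rewrite mulrBr linearB /= [X in _ - X](_ : _ = 0) ?subr0; last first.
  rewrite phi_shifted_sigma shifted_sigmaE -sumrB mulr_sumr phi_sum.
  apply: big1 => l /theta_seed[_ tS]; rewrite -scalerBr -scalerAr linearZ /=.
  set u := (_ + _)%MM; have /andP[after neq] := seed_mul_after admW keyk tS lvm lee.
  suff -> : phi ('X_j * ('X_[u] - nf u)) = 0 by rewrite scaler0.
  case: (boolP (inO u)) => [/nf_O->|uN]; first by rewrite subrr mulr0 linear0.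
  case: (leqP (mdeg u) s) => [degu|degu]; first by apply: IH => //; rewrite mem_N // uN leqW.
  by rewrite (nf_high degu) subr0 -mpolyXD lin_extX nf_high // mdegD (leq_trans degu) // leq_addl.
have U0 i : U_(i)%MM != 0%MM :> monom by rewrite mnm1_eq0.
rewrite mulrDr linearD /= phi_mul_Y ?U0 // addr0.
have jF k' m' : (e k' <= m' k')%N -> 'X_j * F k' m' = F k' (m' + U_(j))%MM.
  move=> le'; rewrite /F /shifted_sigma mulrDr mulrA -!mpolyXD addmC; congr (_ + 'X_[_] * _).
  by rewrite addmBA ?mulU_le // addmC.
have mjN : ~~ inO (m + U_(j))%MM by apply: notin_O_U admW _ _ mN.
have Ymj : Y (m + U_(j))%MM = 0 by rewrite Y0 // notin_LM_U.
(* If x_j <= x_k, then x_k still leads x_j m and [phi_F] applies directly. *)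
case: (leqP k j) => [lekj|ltjk].
  have lvmj : lv (m + U_(j))%MM = Some k.
    apply: lvI; first by rewrite mnmDE ltn_addr // (lv_pos lvm).
    by move=> i ltik; rewrite mnmDE (lv0 lvm) // mnm1E -val_eqE /= gtn_eqF // (leq_trans ltik).
  rewrite jF //; have := phi_F mjN lvmj keyk; rewrite Ymj addr0; apply.
  by rewrite mnmDE (leq_trans lee) ?leq_addr.
have [keyj ej] := key_lt admW mN degm lvm ltjk.
have lv_j (u : monom) : (forall i, (i < k)%N -> u i = 0%N) ->
    lv (u + U_(j))%MM = Some j /\ (e j <= (u + U_(j))%MM j)%N.
  move=> u0; rewrite ej mnmDE mnm1E eqxx addn1; split=> //.
  apply: lvI; first by rewrite mnmDE mnm1E eqxx addn1.
  by move=> i ltij; rewrite mnmDE u0 ?(ltn_trans ltij) // mnm1E -val_eqE /= gtn_eqF.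
have FjE (u : monom) : F j (u + U_(j))%MM = 'X_[u] * ('X_j + sigma j).
  by rewrite /F /shifted_sigma ej mulm1n addmK mpolyXD mulrDr.
have FkE : F k m = 'X_[m - U_(k) *+ e k] * ('X_[U_(k) *+ e k] + sigma k).
  by rewrite /F mulrDr -mpolyXD submK // mulU_le.
(* Write x_j as (x_j + sigma_j) - sigma_j and expand the bracket against the two terms of
   [F k m]. *)
have -> : 'X_j * F k m = F j (m + U_(j))%MM + shifted_sigma m k * ('X_j + sigma j)
    - sigma j * F k m.
  by rewrite FjE FkE /shifted_sigma -{2}(@submK _ (U_(k) *+ e k)%MM m) ?mulU_le // mpolyXD; ring.
rewrite linearB linearD /=.
have [lvmj lej] := lv_j m (fun i => lv0 lvm).
have := phi_F mjN lvmj keyj lej; rewrite Ymj addr0 => ->; rewrite add0r.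
rewrite [X in X - _](_ : _ = 0) ?sub0r; last first.
  rewrite shifted_sigmaE mulr_suml phi_sum; apply: big1 => l /theta_seed[_ tS].
  rewrite -scalerAl -FjE linearZ /=; set u := (_ + (ssval l).2)%MM.
  have u0 i : (i < k)%N -> u i = 0%N.
    by move=> ltik; rewrite mnmDE mnmBE (lv0 lvm) // (seed_lt admW keyk tS).
  have [lvuj leuj] := lv_j u u0.
  have degu : (mdeg m <= mdeg u)%N by apply: seed_mul_deg.
  have uN : ~~ inO (u + U_(j))%MM.
    apply: (notin_O_lv admW mN lvm ltjk); first by rewrite (lv_pos lvuj).
    by rewrite mdegD (leq_trans degu) ?leq_addr.
  have := phi_F uN lvuj keyj leuj; rewrite Y0 ?addr0 => [->|]; first by rewrite scaler0.
  (* x_j u is not in LM: dividing it by a variable of u leaves the factor x_j and a degree at least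
     that of m, hence a monomial outside O. *)
  have /mnm_posP[i ui] : u != 0%MM.
    by rewrite -mdeg_eq0 -lt0n (leq_trans _ degu) // (leq_trans (lv_pos lvm)) ?mdeg_ge.
  apply/(mem_LM admW) => -[_ _ /(_ i)]; rewrite mnmDE ltn_addr // => /(_ isT).
  apply/negP; apply: (notin_O_lv admW mN lvm ltjk).
    rewrite mnmBE mnmDE !mnm1E eqxx; case: eqVneq => [eqij|_]; last by rewrite subn0 addn1.
    by move: ui; rewrite eqij u0.
  have := mdeg_pred (m := (u + U_(j))%MM) (i := i); rewrite mnmDE ltn_addr // mdegD mdeg1.
  by move=> /(_ isT); lia.
rewrite [phi _](_ : _ = 0) ?oppr0 // mulr_suml phi_sum; apply: big1 => l /theta_seed[_ tS].
rewrite -scalerAl linearZ /=; set t := (ssval l).2 in tS *.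
(* As e_j = 1, a seed t of x_j is not 1, so that t [Y m] is killed, and it does not contain x_j; its
   variables are smaller than x_j, hence stable by the outer induction. *)
have t0 : t != 0%MM by rewrite -mdeg_eq0 -lt0n -[X in (X <= _)%N]ej; apply: seed_deg.
have tstab i : (0 < t i)%N -> stable i.
  move=> ti; apply: stab; rewrite ltnNge; apply: contraL ti; rewrite leq_eqVlt -leqNgt leqn0.
  case/orP=> [/eqP/val_inj->|/(seed_lt admW keyj tS)->//].
  by have := seed_key admW keyj tS; rewrite ej ltnS leqn0.
have := stable_monom tstab (phi_F mN lvm keyk lee).
by rewrite mulrDr linearD /= phi_mul_Y // addr0 => ->; rewrite scaler0.
Qed.

End NormalForm.

(** * Generated ideals and their quotients *)

Section GeneratedIdealTheory.
Variables (A : comNzRingType) (B : comAlgType A).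
Implicit Types (G : seq B) (p q : B).

Lemma gen_ideal_ind G (Q : B -> Prop) : Q 0 ->
  (forall p q, Q p -> Q q -> Q (p + q)) -> (forall h g, g \in G -> Q (h * g)) ->
  forall p, p \in gen_ideal G -> Q p.
Proof.
move=> Q0 QD QM p /asboolP[h ->]; apply: big_ind => // i _.
exact/QM/mem_nth.
Qed.

Lemma gen_idealM G h p : p \in gen_ideal G -> h * p \in gen_ideal G.
Proof.
move=> /asboolP[h' ->]; apply/asboolP; exists (fun i => h * h' i).
by rewrite mulr_sumr; apply: eq_bigr => i _; rewrite mulrA.
Qed.

Lemma mem_gen_ideal G g : g \in G -> g \in gen_ideal G.
Proof.
move=> gG; have ltg : (index g G < size G)%N by rewrite index_mem.
apply/asboolP; exists (fun i => (i == Ordinal ltg)%:R).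
rewrite (bigD1 (Ordinal ltg)) //= eqxx mul1r nth_index // big1 ?addr0 //.
by move=> i /negbTE->; rewrite mul0r.
Qed.

Lemma gen_idealS G G' : {subset G <= G'} -> {subset gen_ideal G <= gen_ideal G'}.
Proof.
move=> sub; apply: gen_ideal_ind => [|p q|h g /sub gG']; first exact: rpred0.
  exact: rpredD.
exact/gen_idealM/mem_gen_ideal.
Qed.

Lemma quotient_projZ G a p : quotient_proj G (a *: p) = a *: quotient_proj G p.
Proof. by rewrite -quotient_scaleE. Qed.

Lemma quotient_proj_eq0 G p : quotient_proj G p = 0 <-> p \in gen_ideal G.
Proof.
have <- : quotient_proj G 0 = 0.
  by have := quotient_projD G 0 0; rewrite addr0 => /esym/eqP; rewrite -subr_eq0 addrK => /eqP.
split=> [/quotient_projP|pG]; first by rewrite subr0.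
by apply/quotient_projP; rewrite subr0.
Qed.

Lemma quotient_proj_sum G (I : Type) (l : seq I) (D : pred I) (F : I -> B) :
  quotient_proj G (\sum_(i <- l | D i) F i) = \sum_(i <- l | D i) quotient_proj G (F i).
Proof.
apply: (big_morph (quotient_proj G)) => [p q|]; first exact: quotient_projD.
exact/quotient_proj_eq0/rpred0.
Qed.

End GeneratedIdealTheory.

(** The last two hypotheses say that the span of O is a complement of the ideal. As O has no
    duplicates, a combination indexed by positions in O vanishes only if its coefficients do. *)
Lemma quotient_free_onP (A : comNzRingType) (n : nat) (G : seq {mpoly A[n]})
    (O : seq 'X_{1..n}) : uniq O ->
  (forall p, exists2 q, {subset msupp q <= O} & p - q \in gen_ideal G) ->
  (forall q, {subset msupp q <= O} -> q \in gen_ideal G -> q = 0) ->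
  quotient_free_on G O.
Proof.
move=> uO spanG freeG; set v := [seq quotient_proj G 'X_[t] | t <- O].
have sz_v : size v = size O by apply: size_map.
have lti (i : 'I_(size v)) : (i < size O)%N by rewrite -sz_v.
have combE (c : 'I_(size v) -> A) :
    \sum_i c i *: v`_i = quotient_proj G (\sum_i c i *: 'X_[nth 0%MM O i]).
  rewrite quotient_proj_sum; apply: eq_bigr => i _.
  by rewrite quotient_projZ (nth_map 0%MM).
split=> [x|c].
  elim/quotient_projW: x => p; have [q qO pqI] := spanG p.
  exists (fun i => q@_(nth 0%MM O i)); rewrite combE.
  have qE : q = \sum_(t <- O) q@_t *: 'X_[t].
    by rewrite -(lin_extE _ uO qO) lin_ext.unlock; apply: mpolyE.
  have -> : \sum_(i < size v) q@_(nth 0%MM O i) *: 'X_[nth 0%MM O i] = q.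
    by rewrite [RHS]qE (big_nth 0%MM) big_mkord sz_v.
  exact/quotient_projP.
rewrite combE => /quotient_proj_eq0 qI i; set q := \sum_i _ in qI.
have q0 : q = 0.
  apply: freeG qI => m; rewrite mcoeff_msupp raddf_sum /=; apply: contraR => mO.
  rewrite big1 // => j _; rewrite mcoeffZ mcoeffX; case: eqVneq => [eqm|]; last by rewrite mulr0.
  by case/negP: mO; rewrite -eqm mem_nth.
have := congr1 (mcoeff (nth 0%MM O i)) q0; rewrite mcoeff0 raddf_sum /= (bigD1 i) //=.
rewrite mcoeffZ mcoeffX eqxx mulr1 big1 ?addr0 // => j neqji.
by rewrite mcoeffZ mcoeffX nth_uniq // val_eqE (negbTE neqji) mulr0.
Qed.

(** * The span of O as a complement of the ideals of MG and MG+ *)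

Section MarkedBases.
Variables (n r s : nat) (W : nat -> 'X_{1..n.+1}).
Hypothesis admW : admissible r s W.
Variable K : closedFieldType.
Local Notation inO := (in_O r s W).
Local Notation R := (coeff_ring r s W K).
Local Notation P := {mpoly R[n.+1]}.
Local Notation nf := (@nf n r s W K).
Local Notation phi := (lin_ext nf).
Local Notation MG := (MG r s W K).
Local Notation MGplus := (MGplus r s W K).
Implicit Types (m t b : 'X_{1..n.+1}) (p q : P).

Lemma markedE m : ~~ inO m -> 'X_[m] + Y r s W K m + target r s W K m = 'X_[m] - nf m.
Proof. by move=> mN; rewrite nf_notin_O // opprK addrA. Qed.

Lemma MG_sub : {subset MG <= MGplus}.
Proof. by move=> p /mapP[b /(border_N admW) bN ->]; apply: map_f. Qed.

(** Each generator is some m - [nf m], killed because [phi] fixes [nf m]; stability extends this to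
    multiples. *)
Lemma phi_ideal p : p \in gen_ideal MGplus -> phi p = 0.
Proof.
move: p; apply: gen_ideal_ind => [|p q p0 q0|h g]; first exact: linear0.
  by rewrite linearD /= p0 q0 addr0.
case/mapP=> m; rewrite mem_N // => /andP[_ mN] ->; rewrite markedE //.
rewrite [h]mpolyE mulr_suml phi_sum big1 // => u _.
rewrite -scalerAl linearZ /= (stable_monom (fun i _ => stable_var admW i)) ?scaler0 //.
by rewrite linearB /= lin_extX phi_nf // subrr.
Qed.

Lemma spanO_msupp p : spanO p <-> {subset msupp p <= O_ r s W}.
Proof.
split=> [pO m|sub m mN].
  by rewrite mcoeff_msupp mem_O //; apply: contraR => /pO->.
by apply/eqP; rewrite mcoeff_eq0; apply: contra mN => /sub; rewrite mem_O.
Qed.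

Lemma border_sub_nf b : b \in border r s W -> 'X_[b] - nf b \in gen_ideal MG.
Proof.
move=> bB; rewrite -markedE; first exact/mem_gen_ideal/map_f.
by move: bB; rewrite mem_border // => /andP[].
Qed.

(** Reduce m / x_k to the span of O by induction on the degree, then multiply by x_k. Each x_k t
    with t in O lies in O or in the border, where a generator of MG rewrites it. *)
Lemma span_border m : exists2 q : P, spanO q & 'X_[m] - q \in gen_ideal MG.
Proof.
elim: {m}(mdeg m) {-2}m (erefl (mdeg m)) => [|d IH] m degm.
  exists 'X_[m]; last by rewrite subrr rpred0.
  by apply: spanOX; move/eqP: degm; rewrite mdeg_eq0 => /eqP->; apply: in_O0 admW.
have /mnm_posP[k mk] : m != 0%MM by rewrite -mdeg_eq0 degm.
have [|q qO mqI] := IH (m - U_(k))%MM; first by move: degm; rewrite (mdeg_pred mk) => -[].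
exists (phi ('X_k * q)); first exact: spanO_phiW.
have -> : 'X_[m] - phi ('X_k * q) =
    'X_k * ('X_[m - U_(k)] - q) + ('X_k * q - phi ('X_k * q)).
  by rewrite mulrBr -mpolyXD addmC submK ?lep1mP -?lt0n // addrA subrK.
apply: rpredD; first exact: gen_idealM.
rewrite [q]mpolyE mulr_sumr phi_sum -sumrB big_seq; apply: rpred_sum => t.
rewrite mcoeff_msupp => qt0; have tO : inO t by apply: contraR qt0 => /qO->.
rewrite -scalerAr linearZ /= -scalerBr; apply: gen_idealZ.
rewrite -mpolyXD lin_extX addmC.
case: (boolP (inO (t + U_(k))%MM)) => [/nf_O->|tkN]; first by rewrite subrr rpred0.
exact/border_sub_nf/in_border_U.
Qed.

Lemma span_MG p : exists2 q, spanO q & p - q \in gen_ideal MG.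
Proof.
elim/mpolyind: p => [|c m p _ _ [q qO pqI]].
  by exists 0; [move=> m _; apply: mcoeff0 | rewrite subrr rpred0].
have [q' q'O mI] := span_border m; exists (c *: q' + q).
  by move=> u uN; rewrite mcoeffD mcoeffZ q'O // qO // mulr0 addr0.
by rewrite opprD addrACA -scalerBr rpredD // gen_idealZ.
Qed.

(** Spanning passes from MG up to G, and independence from MG+ down to G; this covers MG and MG+ at
    once. *)
Lemma quotient_free_on_O G : {subset MG <= G} -> {subset G <= MGplus} ->
  quotient_free_on G (O_ r s W).
Proof.
move=> subG Gsub; apply: quotient_free_onP; first exact: uniq_O.
  move=> p; have [q /spanO_msupp qO pqI] := span_MG p; exists q => //.
  exact: gen_idealS pqI.
move=> q /spanO_msupp qO qI; rewrite -[q](spanO_phi qO); apply: phi_ideal.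
exact: gen_idealS qI.
Qed.

Lemma spanO_sum q : spanO q -> q = \sum_(t <- O_ r s W) q@_t *: 'X_[t].
Proof.
move=> /spanO_msupp qO; rewrite -(lin_extE _ (uniq_O r s W) qO) lin_ext.unlock.
exact: mpolyE.
Qed.

Lemma border_prebasis_MG : border_prebasis (O_ r s W) (border r s W) MG.
Proof.
(* The coefficients are those of the normal forms of the border monomials, which lie in the span of
   O. *)
exists (fun t b => (nf b)@_t); suff -> : MG = [seq 'X_[b] - nf b | b <- border r s W].
  by move=> p; congr (_ \in _); apply/eq_map => b; rewrite -spanO_sum //; apply: spanO_nf.
apply/eq_in_map => b; rewrite mem_border // => /andP[bN _].
exact: markedE.
Qed.

End MarkedBases.

Theorem corollary3 (K : closedFieldType) (charK : [pchar K] =i pred0)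
    (n r s : nat) (W : nat -> 'X_{1..n.+1}) (admW : admissible r s W) :
  quotient_free_on (MGplus r s W K) (O_ r s W) /\
  border_basis (O_ r s W) (border r s W) (MG r s W K).
Proof.
split; first by apply: quotient_free_on_O => //; apply: MG_sub.
split; first exact: border_prebasis_MG.
by apply: quotient_free_on_O => //; apply: MG_sub.
Qed.
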